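(* Let $G$ and $H$ be finitely generated free groups, let $g_1,\dots,g_n$ be a fixed free generating set of $G$, let $\phi,\psi: G\to H$ be homomorphisms, and let $u,v\in H$ be distinct words. Suppose that $\phi^v*\psi: G*G\to H$ has remnant, and that, for each generator $g\in\{g_1,\dots,g_n,g_1',\dots,g_n'\}$ of $G*G$, the remnant word $\operatorname{Rem}_{\phi^v*\psi}(g)$ (a subword of $(\phi^v*\psi)(g)$) does not fully cancel in any product of the form $$\big((\phi^v*\psi)(g)\big)\,v^{-1}u,\qquad u^{-1}v\,\big((\phi^v*\psi)(g)\big).$$ Then $[u]\neq[v]$, i.e. $u$ and $v$ are in different doubly-twisted conjugacy classes with respect to $\phi$ and $\psi$.
   Context: Doubly-twisted conjugacy: for homomorphisms $\phi,\psi:G\to H$ and $u,v\in H$, write $[u]=[v]$ if and only if there is some $g\in G$ with $u=\phi(g)\,v\,\psi(g)^{-1}$; the resulting equivalence classes in $H$ are the doubly-twisted conjugacy classes. Notation: for $v\in H$, $\phi^v:G\to H$ is the homomorphism $\phi^v(g)=v^{-1}\phi(g)v$. For homomorphisms $\alpha,\beta:G\to H$ with $G=\langle g_1,\dots,g_n\rangle$ free, write the free product $G*G=\langle g_1,\dots,g_n,g_1',\dots,g_n'\rangle$, and define $\alpha*\beta:G*G\to H$ by $(\alpha*\beta)(g_i)=\alpha(g_i)$ and $(\alpha*\beta)(g_i')=\beta(g_i)$. Elements of $H$ are identified with reduced words in a fixed free generating set of $H$. In a product of reduced words, letters cancel by free reduction; a subword has no cancellation in a product of two reduced words if none of its letters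 cancels when the product is reduced, and it fully cancels if all of its letters cancel. Remnant: let $K$ be a finitely generated free group with a specified free generating set $\{k_1,\dots,k_m\}$ and let $\eta:K\to H$ be a homomorphism. Then $\eta$ has remnant if for each $i$ the word $\eta(k_i)$ has a nontrivial subword which has no cancellation in any of the products $\eta(k_j)^{\pm1}\eta(k_i)$, $\eta(k_i)\eta(k_j)^{\pm1}$ (over all $j$ and both signs), except for $j=i$ with exponent $-1$. The maximal such noncancelling subword of $\eta(k_i)$ is called the remnant of $k_i$, written $\operatorname{Rem}_\eta(k_i)$. For $K=G*G$ the specified generating set is $\{g_1,\dots,g_n,g_1',\dots,g_n'\}$. *)

(* Defs.v *)
From HB Require Import structures.
From mathcomp Require Import all_boot.

Set Implicit Arguments.
Unset Strict Implicit.
Unset Printing Implicit Defensive.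

Local Open Scope group_scope.

(* The free group on X: reduced words in the letters (x, true), standing for  *)
(* x, and (x, false), standing for the inverse of x.                          *)
Section FreeGroup.
Variable X : choiceType.
Implicit Types (a b : X * bool) (s t : seq (X * bool)).

Definition inv_letter a : X * bool := (a.1, ~~ a.2).

Definition reduced s : bool := sorted (fun a b => b != inv_letter a) s.

Definition push a s : seq (X * bool) :=
  if s is b :: t then if b == inv_letter a then t else a :: s else [:: a].

Definition reduce s : seq (X * bool) := foldr push [::] s.

Record freeGroup : predArgType :=
  FreeGroup { word : seq (X * bool); word_reduced : reduced word }.

HB.instance Definition _ := [isSub for word].
HB.instance Definition _ := [Choice of freeGroup by <:].

Lemma inv_letterK : involutive inv_letter.
Proof. by case=> x e; rewrite /inv_letter /= negbK. Qed.

Lemma eq_inv_letter a b : (a == inv_letter b) = (b == inv_letter a).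
Proof. by apply/eqP/eqP => ->; rewrite inv_letterK. Qed.

Lemma reduced_behead a s : reduced (a :: s) -> reduced s.
Proof. by case: s => //= b s /andP[]. Qed.

Lemma push_reduced a s : reduced s -> reduced (push a s).
Proof.
case: s => //= b s Hs; case: ifP => [_|/negbT nab]; last by rewrite /= nab.
exact: (@reduced_behead b).
Qed.

Lemma foldr_push_reduced s t : reduced t -> reduced (foldr push t s).
Proof. by move=> Ht; elim: s => //= a s; apply: push_reduced. Qed.

Lemma reduce_reduced s : reduced (reduce s).
Proof. exact: foldr_push_reduced. Qed.

Lemma push_inv a s : reduced s -> push a (push (inv_letter a) s) = s.
Proof.
case: s => [|b s] /=; first by rewrite eqxx.
rewrite inv_letterK; have [->|nba] := eqVneq b a; last by rewrite /= eqxx.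
by case: s => //= c s /andP[/negbTE ->].
Qed.

Lemma foldr_push_push a s t : reduced t ->
  foldr push t (push a s) = push a (foldr push t s).
Proof.
case: s => //= b s Ht; case: eqP => [->|//].
by rewrite push_inv //; apply: foldr_push_reduced.
Qed.

Lemma foldr_push_reduce s t : reduced t ->
  foldr push t (reduce s) = foldr push t s.
Proof. by move=> Ht; elim: s => //= a s IHs; rewrite foldr_push_push ?IHs. Qed.

Lemma reduce_id s : reduced s -> reduce s = s.
Proof.
elim: s => //= a s IHs Hs; rewrite IHs ?(reduced_behead Hs) //.
by case: s Hs {IHs} => //= b s /andP[/negbTE ->].
Qed.

Lemma reduce_cat s t : reduce (s ++ t) = reduce (reduce s ++ reduce t).
Proof.
rewrite /reduce !foldr_cat -!/(reduce _) (reduce_id (reduce_reduced t)).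
by rewrite foldr_push_reduce // reduce_reduced.
Qed.

Definition inv_word s : seq (X * bool) := rev (map inv_letter s).

Lemma inv_wordK : involutive inv_word.
Proof. by move=> s; rewrite /inv_word map_rev revK (mapK inv_letterK). Qed.

Lemma inv_word_reduced s : reduced s -> reduced (inv_word s).
Proof.
rewrite /reduced /inv_word rev_sorted sorted_map.
by apply: sub_sorted => a b; rewrite /= inv_letterK eq_sym.
Qed.

Lemma reduce_invl s : reduce (inv_word s ++ s) = [::].
Proof.
elim: s => //= a s IHs; rewrite /inv_word /= rev_cons cat_rcons /reduce foldr_cat /=.
rewrite -/(reduce s) -[X in push X (push _ _)]/(inv_letter a).
have := push_inv (inv_letter a) (reduce_reduced s); rewrite inv_letterK => ->.
by move: IHs; rewrite /reduce foldr_cat.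
Qed.

Lemma reduce_invr s : reduce (s ++ inv_word s) = [::].
Proof. by rewrite -{1}[s]inv_wordK reduce_invl. Qed.

Definition free_one : freeGroup := @FreeGroup [::] isT.
Definition free_inv (x : freeGroup) : freeGroup :=
  FreeGroup (inv_word_reduced (word_reduced x)).
Definition free_mul (x y : freeGroup) : freeGroup :=
  FreeGroup (reduce_reduced (word x ++ word y)).

Lemma free_mulA : associative free_mul.
Proof.
move=> x y z; apply: val_inj => /=.
rewrite reduce_cat (reduce_id (reduce_reduced _)) -reduce_cat catA.
by rewrite [RHS]reduce_cat (reduce_id (reduce_reduced _)) -reduce_cat.
Qed.

Lemma free_mul1g : left_id free_one free_mul.
Proof. by move=> x; apply: val_inj; rewrite /= reduce_id ?word_reduced. Qed.

Lemma free_mulg1 : right_id free_one free_mul.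
Proof. by move=> x; apply: val_inj; rewrite /= cats0 reduce_id ?word_reduced. Qed.

Lemma free_mulVg : left_inverse free_one free_inv free_mul.
Proof. by move=> x; apply: val_inj; rewrite /= reduce_invl. Qed.

Lemma free_mulgV : right_inverse free_one free_inv free_mul.
Proof. by move=> x; apply: val_inj; rewrite /= reduce_invr. Qed.

HB.instance Definition _ := isGroup.Build freeGroup
  free_mulA free_mul1g free_mulg1 free_mulVg free_mulgV.

Definition gen (x : X) : freeGroup := @FreeGroup [:: (x, true)] isT.

End FreeGroup.

Definition signed (G : groupType) (e : bool) (x : G) : G := if e then x else x^-1.

Section Extend.
Variables (X : choiceType) (G : groupType) (f : X -> G).

Definition eval_word (s : seq (X * bool)) : G := \prod_(a <- s) signed a.2 (f a.1).

Definition extend (x : freeGroup X) : G := eval_word (word x).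

Lemma eval_push a s : eval_word (push a s) = signed a.2 (f a.1) * eval_word s.
Proof.
case: s => [|b s] /=; first by rewrite /eval_word big_cons.
rewrite /eval_word; case: eqP => [->|_]; rewrite !big_cons //= mulgA.
by case: a => x [] /=; rewrite ?mulgV ?mulVg mul1g.
Qed.

Lemma eval_reduce s : eval_word (reduce s) = eval_word s.
Proof.
by elim: s => //= a s IHs; rewrite eval_push IHs /eval_word big_cons.
Qed.

Lemma extend_monoid_morphism : monoid_morphism extend.
Proof.
split; first by rewrite /extend /eval_word big_nil.
by move=> x y; rewrite /extend /= eval_reduce /eval_word big_cat.
Qed.

HB.instance Definition _ :=
  isUMagmaMorphism.Build (freeGroup X) G extend extend_monoid_morphism.

Lemma extend_gen x : extend (gen x) = f x.
Proof. by rewrite /extend /eval_word big_seq1. Qed.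

End Extend.

Definition free_generators (X : choiceType) (G : groupType) (g : X -> G) : Prop :=
  bijective (extend g).

Section Twist.
Variables (G H : groupType) (phi : UMagmaMorphism.type G H) (v : H).

Definition twist (x : G) : H := phi x ^ v.

Lemma twist_monoid_morphism : monoid_morphism twist.
Proof.
by split=> [|x y]; rewrite /twist ?gmulf1 ?conj1g // gmulfM conjMg.
Qed.

HB.instance Definition _ :=
  isUMagmaMorphism.Build G H twist twist_monoid_morphism.

End Twist.

(* For a free generating family g of G indexed by I, the free product G * G   *)
(* is the free group on I + I, where inl i stands for the generator g_i of    *)
(* the first factor and inr i for the generator g_i' of the second one.       *)
Definition free_star (I : choiceType) (G H : groupType) (g : I -> G)
    (alpha beta : UMagmaMorphism.type G H) :
    UMagmaMorphism.type (freeGroup (I + I)%type) H :=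
  extend (fun k => match k with inl i => alpha (g i) | inr i => beta (g i) end).

Definition twisted_conj (G H : groupType) (phi psi : UMagmaMorphism.type G H)
    (u v : H) : Prop :=
  exists g : G, u = phi g * v * (psi g)^-1.

Section Cancellation.
Variable Y : choiceType.
Implicit Types (x y w : freeGroup Y) (s t : seq (Y * bool)).

Fixpoint common_prefix s t : nat :=
  match s, t with
  | a :: s', b :: t' => if a == b then (common_prefix s' t').+1 else 0
  | _, _ => 0
  end.

(* In x * y, this many letters at the end of x cancel against as many letters *)
(* at the beginning of y; see word_mulE.                                      *)
Definition ncancel x y : nat := common_prefix (word x^-1) (word y).

(* The letter of w at position p cancels in the product w * x. *)
Definition cancels_mulr w x (p : nat) : bool :=
  (p < size (word w)) && (size (word w) - ncancel w x <= p).

(* The letter of w at position p cancels in the product x * w. *)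
Definition cancels_mull w x (p : nat) : bool := p < ncancel x w.

Lemma common_prefixE s t :
  let c := common_prefix s t in
  [/\ c <= size s, c <= size t, take c s = take c t &
      forall a b s' t', drop c s = a :: s' -> drop c t = b :: t' -> a != b].
Proof.
elim: s t => [|a s IHs] [|b t] //=.
have [->|nab] /= := eqVneq a b.
  by have [? ? e ?] := IHs t; split=> //; rewrite e.
by split=> // a' b' s' t' [<- _] [<- _].
Qed.

Lemma reduce_cancel s t : reduce (inv_word s ++ s ++ t) = reduce t.
Proof.
rewrite catA reduce_cat reduce_invl cat0s reduce_id //; exact: reduce_reduced.
Qed.

Lemma word_mulE x y :
  word (x * y) =
  take (size (word x) - ncancel x y) (word x) ++ drop (ncancel x y) (word y).
Proof.
rewrite /ncancel /=; set s := inv_word (word x); set t := word y.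
have ws : word x = inv_word s by rewrite inv_wordK.
have rt : reduced t by apply: word_reduced.
have rs : reduced s by apply/inv_word_reduced/word_reduced.
have [] := common_prefixE s t; set c := common_prefix s t => cs ct e ne.
have sz : size (word x) = size s by rewrite /s /inv_word size_rev size_map.
rewrite sz ws.
have -> : take (size s - c) (inv_word s) = inv_word (drop c s).
  by rewrite /inv_word map_drop take_rev size_map subKn.
have -> : reduce (inv_word s ++ t) = reduce (inv_word (drop c s) ++ drop c t).
  rewrite -{1}[s](cat_take_drop c) -{1}[t](cat_take_drop c) -e.
  rewrite {1}/inv_word map_cat rev_cat -!/(inv_word _) -catA.
  by rewrite reduce_cat reduce_cancel -reduce_cat.
apply: reduce_id.
have rd : reduced (inv_word (drop c s)) by apply/inv_word_reduced/drop_sorted.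
have rd' : reduced (drop c t) by apply/drop_sorted.
move: ne rd rd'; case: (drop c s) => [|a s'] ne //; rewrite /inv_word /=.
rewrite rev_cons; case: (drop c t) ne => [|b t'] ne; first by rewrite cats0.
move=> r1 r2; have nab := ne _ _ _ _ (erefl _) (erefl _).
move: r1 r2; rewrite /reduced; case: (rev _) => [|d r] /=.
  by move=> _ ->; rewrite inv_letterK eq_sym nab.
rewrite cat_path last_rcons => -> /= ->.
by rewrite inv_letterK eq_sym nab.
Qed.

End Cancellation.

(* A subword of w is given by its occurrence: the positions p with a <= p < b. *)
(* By has_remnantP and is_remnant_uniq, if eta has remnant then every         *)
(* generator has exactly one remnant.                                         *)
Section Remnant.
Variables (I Y : finType) (eta : UMagmaMorphism.type (freeGroup I) (freeGroup Y)).

Definition nontrivial_subword (w : freeGroup Y) (a b : nat) : Prop :=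
  a < b <= size (word w).

Definition noncancelling (i : I) (a b : nat) : Prop :=
  forall (j : I) (e : bool), (j, e) != (i, false) ->
  forall p, a <= p < b ->
    ~~ cancels_mull (eta (gen i)) (signed e (eta (gen j))) p /\
    ~~ cancels_mulr (eta (gen i)) (signed e (eta (gen j))) p.

Definition has_remnant : Prop :=
  forall i, exists a b,
    nontrivial_subword (eta (gen i)) a b /\ noncancelling i a b.

Definition is_remnant (i : I) (a b : nat) : Prop :=
  [/\ nontrivial_subword (eta (gen i)) a b, noncancelling i a b &
      forall a' b', nontrivial_subword (eta (gen i)) a' b' ->
        noncancelling i a' b' -> a <= a' /\ b' <= b].

Lemma is_remnant_uniq i a b a' b' :
  is_remnant i a b -> is_remnant i a' b' -> a = a' /\ b = b'.
Proof.
move=> [s n m] [s' n' m']; have [l1 l2] := m _ _ s' n'; have [l3 l4] := m' _ _ s n.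
by split; apply/eqP; rewrite eqn_leq ?l1 ?l2 ?l3 ?l4.
Qed.

Lemma has_remnantP : has_remnant <-> forall i, exists a b, is_remnant i a b.
Proof.
split=> [hr i|hr i]; last by have [a [b [s n _]]] := hr i; exists a, b.
pose w := eta (gen i); pose sz := size (word w).
pose z (q : I * bool) := signed q.2 (eta (gen q.1)).
pose L := \max_(q | q != (i, false)) ncancel (z q) w.
pose R := \max_(q | q != (i, false)) ncancel w (z q).
have bnd a b : nontrivial_subword w a b -> noncancelling i a b ->
    L <= a /\ b <= sz - R.
  move=> /andP[ab bs] n; split.
    apply/bigmax_leqP => -[j e] q.
    have [|] := n j e q a; first by rewrite leqnn.
    by rewrite /cancels_mull -leqNgt.
  suff RB : R <= sz - b by rewrite -(subKn bs) leq_sub2l.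
  apply/bigmax_leqP => -[j e] q; case: b ab bs n => // b ab bs n.
  have [|_] := n j e q b; first by rewrite ltnSn andbT.
  rewrite /cancels_mulr -/w -/sz bs /= -ltnNge => lt.
  rewrite /z /=; set c := ncancel _ _ in lt *.
  by rewrite leq_subRL // addSn addnC -ltn_subRL.
exists L, (sz - R).
have [a [b [s n]]] := hr i; have [l1 l2] := bnd _ _ s n.
split=> //.
- move/andP: s => [ab _]; apply/andP; split; last exact: leq_subr.
  exact: leq_ltn_trans l1 (leq_trans ab l2).
- move=> j e q p /andP[p1 p2].
  have c1 : ncancel (z (j, e)) w <= L by apply: (bigmax_sup (j, e)).
  have c2 : ncancel w (z (j, e)) <= R by apply: (bigmax_sup (j, e)).
  rewrite /cancels_mull /cancels_mulr -leqNgt (leq_trans c1 p1); split=> //.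
  rewrite negb_and -!ltnNge; apply/orP; right.
  by apply: leq_trans p2 _; rewrite leq_sub2l.
Qed.

(* The subword of eta (gen i) at positions a <= p < b fully cancels in the    *)
(* product eta (gen i) * x, respectively x * eta (gen i).                     *)
Definition fully_cancels_mulr (i : I) (a b : nat) (x : freeGroup Y) : Prop :=
  forall p, a <= p < b -> cancels_mulr (eta (gen i)) x p.

Definition fully_cancels_mull (i : I) (a b : nat) (x : freeGroup Y) : Prop :=
  forall p, a <= p < b -> cancels_mull (eta (gen i)) x p.

End Remnant.

(* Main.v *)
(* If u = phi(x) v psi(x)^-1, then v^-1 u is the image under eta = phi^v * psi
   of z = x (x')^-1, where x' is the copy of x in the second factor; z is
   reduced, and nonempty as u <> v.  Let k^e be the first letter of z.  As eta
   has remnant, reduction of the image of z never reaches the remnant of this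
   letter, so that the initial part of eta(k)^e up to the end of its remnant is
   a prefix of v^-1 u.  Hence the remnant of k fully cancels in u^-1 v eta(k)
   if e = 1, and in eta(k) v^-1 u if e = -1. *)
Require Import Defs.
From mathcomp Require Import all_boot.

Set Implicit Arguments.
Unset Strict Implicit.
Unset Printing Implicit Defensive.

Local Open Scope group_scope.

Section CommonPrefix.
Variable Y : choiceType.
Implicit Types (s t : seq (Y * bool)) (x y z : freeGroup Y).

Lemma leq_common_prefix s t c : take c s = take c t -> c <= size s ->
  c <= common_prefix s t.
Proof.
elim: s t c => [|a s IHs] [|b t] [|c] //= -[-> e] ?.
by rewrite eqxx ltnS IHs.
Qed.

(** The comparison with [s] is decided within the first [h] letters, where [t] and [t'] agree. This
    lets a single letter's image stand in for the image of a whole word when cancelled letters are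
    counted. *)
Lemma common_prefix_take s t t' h : take h t = take h t' ->
  common_prefix s t < h -> common_prefix s t' = common_prefix s t.
Proof.
elim: s t t' h => [|a s IHs] [|b t] [|b' t'] [|h] //= [<-].
by case: eqP => //= _ e lt; rewrite (IHs t t' h).
Qed.

Lemma common_prefixC s t : common_prefix s t = common_prefix t s.
Proof.
by elim: s t => [|a s IHs] [|b t] //=; rewrite eq_sym IHs.
Qed.

Lemma ncancelV x y : ncancel y^-1 x^-1 = ncancel x y.
Proof. by rewrite /ncancel invgK common_prefixC. Qed.

Lemma size_wordV x : size (word x^-1) = size (word x).
Proof. by rewrite /= /inv_word size_rev size_map. Qed.

Lemma take_word_mul x y h : h + ncancel x y <= size (word x) ->
  take h (word (x * y)) = take h (word x).
Proof.
move=> le; have le' : h <= size (word x) - ncancel x y 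
  by rewrite leq_subRL 1?addnC // (leq_trans _ le) ?leq_addl.
rewrite word_mulE take_cat size_take_min.
have -> : minn (size (word x) - ncancel x y) (size (word x)) =
          size (word x) - ncancel x y by apply/minn_idPl/leq_subr.
case: ltnP => [lt|ge]; first by rewrite take_takel // ltnW.
have -> : h = size (word x) - ncancel x y by apply/eqP; rewrite eqn_leq le' ge.
by rewrite subnn take0 cats0.
Qed.

End CommonPrefix.

Lemma signedV (G : groupType) e (x : G) : (signed e x)^-1 = signed (~~ e) x.
Proof. by case: e; rewrite /= ?invgK. Qed.

Lemma eq_eval_word (X : choiceType) (G : groupType) (f1 f2 : X -> G) s :
  f1 =1 f2 -> eval_word f1 s = eval_word f2 s.
Proof. by move=> e; apply: eq_bigr => a _; rewrite e. Qed.

Lemma eval_word_cons (X : choiceType) (G : groupType) (f : X -> G) a s :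
  eval_word f (a :: s) = signed a.2 (f a.1) * eval_word f s.
Proof. by rewrite /eval_word big_cons. Qed.

Lemma eval_word_cat (X : choiceType) (G : groupType) (f : X -> G) s t :
  eval_word f (s ++ t) = eval_word f s * eval_word f t.
Proof. by rewrite /eval_word big_cat. Qed.

Lemma eval_inv_word (X : choiceType) (G : groupType) (f : X -> G) s :
  eval_word f (inv_word s) = (eval_word f s)^-1.
Proof.
apply: (mulIg (eval_word f s)).
by rewrite mulVg -eval_word_cat -eval_reduce reduce_invl /eval_word big_nil.
Qed.

Lemma morph_eval_word (X : choiceType) (G H : groupType)
    (eta : UMagmaMorphism.type G H) (f : X -> G) s :
  eta (eval_word f s) = eval_word (eta \o f) s.
Proof.
elim: s => [|[x e] s IHs]; first by rewrite /eval_word !big_nil gmulf1.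
by rewrite !eval_word_cons gmulfM IHs; case: e; rewrite /= ?gmulfV.
Qed.

Lemma eval_word_map (X X' : choiceType) (G : groupType) (f : X' -> G)
    (h : X -> X') s :
  eval_word f [seq (h a.1, a.2) | a <- s] = eval_word (f \o h) s.
Proof. by rewrite /eval_word big_map. Qed.

Section RemnantPrefix.
Variables (I Y : finType) (eta : UMagmaMorphism.type (freeGroup I) (freeGroup Y)).

(* If the remnant of i occupies the positions a <= p < b of eta (gen i), its
   inverse occupies those from size - b to size - a in the inverse word. *)
Definition remnant_end (i : I) (a b : nat) (e : bool) : nat :=
  if e then b else size (word (eta (gen i))) - a.

(** Cancellation removes a suffix of the left factor, so one letter of the segment decides: the one
    at [b.-1] if [e] holds, otherwise the one at [a], which comes last in the inverse word. *)
Lemma ncancel_signed_left i a b e j d :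
  nontrivial_subword (eta (gen i)) a b -> noncancelling eta i a b ->
  (j, d) != (i, ~~ e) ->
  remnant_end i a b e + ncancel (signed e (eta (gen i))) (signed d (eta (gen j)))
    <= size (word (signed e (eta (gen i)))).
Proof.
move=> /andP[ab bs] nc ne; case: e ne => ne /=.
  have bb : a <= b.-1 < b by case: b ab {bs nc} => // b; rewrite ltnSn andbT.
  have [_] := nc j d ne _ bb; case: b ab bs {nc bb} => // b _ bs.
  by rewrite /cancels_mulr bs /= -ltnNge ltn_subRL addnC.
have ne' : (j, ~~ d) != (i, false).
  by apply: contra ne => /eqP[-> /negbFE ->].
(* Inverting the product makes [eta (gen i)] the right factor and flips [d]. *)
have [] := nc j (~~ d) ne' a; first by rewrite leqnn.
rewrite /cancels_mull -leqNgt -ncancelV signedV negbK => le _.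
rewrite -[inv_word _]/(word (eta (gen i))^-1) size_wordV.
rewrite -leq_subRL ?leq_subr // subKn //.
by rewrite (leq_trans (ltnW ab)).
Qed.

(** Inverting the product reduces this to [ncancel_signed_left] with both signs flipped: at most the
    letters before the segment cancel, and the segment is nonempty. *)
Lemma ncancel_signed_right i a b e j d :
  nontrivial_subword (eta (gen i)) a b -> noncancelling eta i a b ->
  (j, d) != (i, ~~ e) ->
  ncancel (signed d (eta (gen j))) (signed e (eta (gen i))) < remnant_end i a b e.
Proof.
move=> ab nc ne; have ne' : (j, ~~ d) != (i, ~~ ~~ e).
  by apply: contra ne => /eqP[-> /negb_inj ->].
rewrite -ncancelV !signedV; have := ncancel_signed_left ab nc ne'.
case/andP: ab => ltab bs; case: (e) => /=.
  rewrite -[inv_word _]/(word (eta (gen i))^-1) size_wordV.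
  rewrite -leq_subRL ?leq_subr // subKn; last exact: leq_trans (ltnW ltab) bs.
  by move/leq_ltn_trans; apply.
rewrite -leq_subRL // => /leq_ltn_trans; apply.
by rewrite ltn_sub2l // (leq_trans ltab).
Qed.

Hypothesis hrem : has_remnant eta.

(** Induction on the word, for all noncancelling segments at once. The image of the tail starts like
    that of its first letter up to the end of a noncancelling segment, and cancellation with the
    preceding letter's image stops before that point, so it is the same as for the two letters
    alone. *)
Lemma remnant_prefix i e s a b :
  nontrivial_subword (eta (gen i)) a b -> noncancelling eta i a b ->
  reduced ((i, e) :: s) ->
  take (remnant_end i a b e) (word (eval_word (eta \o @gen I) ((i, e) :: s))) =
  take (remnant_end i a b e) (word (signed e (eta (gen i)))).
Proof.
elim: s i e a b => [|[j d] s IHs] i e a b ab nc.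
  by rewrite eval_word_cons /eval_word big_nil mulg1.
case/andP=> ne red; rewrite eval_word_cons; apply: take_word_mul.
have [a' [b' [ab' nc']]] := hrem j.
have ne' : (i, e) != (j, ~~ d).
  by apply: contra ne => /eqP[-> ->]; rewrite /inv_letter /= negbK.
rewrite /ncancel (common_prefix_take (esym (IHs j d a' b' ab' nc' red))).
  exact: ncancel_signed_left.
exact: ncancel_signed_right.
Qed.

(** By [remnant_prefix], [x] and the signed image of [i] share a prefix containing the whole
    segment, and a common prefix is what cancels when one word is multiplied on the left by the
    inverse of the other. *)
Lemma remnant_cancels i e s a b :
  nontrivial_subword (eta (gen i)) a b -> noncancelling eta i a b ->
  reduced ((i, e) :: s) ->
  let x := eval_word (eta \o @gen I) ((i, e) :: s) in
  if e then fully_cancels_mull eta i a b x^-1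
  else fully_cancels_mulr eta i a b x.
Proof.
move=> ab nc red x; have := remnant_prefix ab nc red; rewrite -/x.
have [/andP[ltab bs]] := (ab).
case: e @x red => x red /= pre p /andP[ap pb].
  apply: leq_trans pb _; rewrite /ncancel invgK common_prefixC.
  exact: leq_common_prefix.
(* The first [size - a] letters of the inverse word are the inverses of those at positions from [a]
   on. *)
rewrite /cancels_mulr (leq_trans pb bs) /=; apply: leq_trans ap.
rewrite leq_subCl; apply: leq_common_prefix; first exact: esym.
by rewrite size_wordV leq_subr.
Qed.

End RemnantPrefix.

(** At the junction an [inl] letter meets an [inr] letter, and these are never inverse to each
    other. *)
Lemma reduced_star_word (I J : choiceType) (s : seq (I * bool)) (t : seq (J * bool)) :
  reduced s -> reduced t ->
  reduced ([seq ((inl a.1 : I + J)%type, a.2) | a <- s] ++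
           [seq (inr a.1, a.2) | a <- t]).
Proof.
move=> rs rt.
have {rt} : reduced [seq ((inr a.1 : I + J)%type, a.2) | a <- t].
  by rewrite /reduced sorted_map; apply: sub_sorted rt => -[? ?] [? ?].
have {rs} : reduced [seq ((inl a.1 : I + J)%type, a.2) | a <- s].
  by rewrite /reduced sorted_map; apply: sub_sorted rs => -[? ?] [? ?].
rewrite /reduced; case: s => //= a s; rewrite cat_path => -> /=.
by case: t => //= b t ->; rewrite last_map andbT.
Qed.

Theorem theorem5 (n m : nat) (G : groupType) (g : 'I_n -> G)
    (hg : free_generators g)
    (phi psi : UMagmaMorphism.type G (freeGroup 'I_m))
    (u v : freeGroup 'I_m) (huv : u <> v)
    (hrem : has_remnant (free_star g (twist phi v) psi))
    (hcancel : forall (k : ('I_n + 'I_n)%type) (a b : nat),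
       is_remnant (free_star g (twist phi v) psi) k a b ->
       ~ fully_cancels_mulr (free_star g (twist phi v) psi) k a b (v^-1 * u) /\
       ~ fully_cancels_mull (free_star g (twist phi v) psi) k a b (u^-1 * v)) :
  ~ twisted_conj phi psi u v.
Proof.
(* Surjectivity of [extend g] turns the twisting element into a reduced word [x]. *)
case: hg => g' _ g'K [x0 ux]; rewrite -[x0]g'K in ux.
move: (g' x0) ux => x ux {g' g'K x0}.
set eta := free_star g (twist phi v) psi in hrem hcancel.
pose z := [seq ((inl a.1 : 'I_n + 'I_n)%type, a.2) | a <- word x] ++
          [seq (inr a.1, a.2) | a <- inv_word (word x)].
have rz : reduced z.
  by apply: reduced_star_word; [|apply: inv_word_reduced]; apply: word_reduced.
have ez : eval_word (eta \o @gen _) z = v^-1 * u.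
  rewrite eval_word_cat !eval_word_map eval_inv_word.
  rewrite (eq_eval_word (f1 := _ \o inl) (f2 := twist phi v \o g)) => [|i];
    last exact: (extend_gen _ (inl i)).
  rewrite (eq_eval_word (f1 := _ \o inr) (f2 := psi \o g)) => [|i];
    last exact: (extend_gen _ (inr i)).
  by rewrite -!morph_eval_word ux /= /twist conjgE !mulgA.
case: z rz ez => [|[k e] s] rz ez.
  apply: huv; apply: (mulgI v^-1).
  by rewrite -ez /eval_word big_nil mulVg.
have [a [b ab]] := (has_remnantP eta).1 hrem k; have [sub nc _] := ab.
have [nr nl] := hcancel k a b ab.
have := remnant_cancels hrem sub nc rz; rewrite /= ez.
(* For positive [e], [(v^-1 * u)^-1 = u^-1 * v] contradicts [nl]; for negative [e], [nr] applies
   directly. *)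
by case: (e) => //; rewrite invgM invgK.
Qed.
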